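(* Let $(f,g)$ be consistent Cauchy data and assume that the solution $\bar\varphi$ of the fixed point equation $T_l\varphi+z_{f,g}=\varphi$ satisfies the source condition $$\bar\varphi-\varphi_1=F(I-T_l)\,\psi\qquad\text{for some }\psi\in\mathcal{H},$$ where $\varphi_1\in\mathcal{H}$ is some initial guess and $F$ is the function $$F(\lambda)=\bigl(\ln(e\,\lambda^{-1})\bigr)^{-p}\ \ (\lambda>0),\qquad F(0)=0,$$ with $p\ge1$. Let $\mu>2$, let $(f_\varepsilon,g_\varepsilon)$ be some given noisy data with $\|z_\varepsilon-z_{f,g}\|\le\varepsilon$, $\varepsilon>0$, let $\varphi_1^\varepsilon:=\varphi_1$, $\varphi_{k+1}^\varepsilon:=T_l\varphi_k^\varepsilon+z_\varepsilon$ for $k\ge1$, and let $$k(\varepsilon,z_\varepsilon):=\min\{k\in\mathbb{N}\ :\ \|z_\varepsilon-(I-T_l)\varphi_k^\varepsilon\|\le\mu\varepsilon\}$$ be the stopping index determined by the discrepancy principle. Then there exists a constant $C$, depending on $p$ and $\|\psi\|$ only, such that (i) $\|\bar\varphi-\varphi_k^\varepsilon\|\le C\,(\ln k)^{-p}$, (ii) $\|z_\varepsilon-(I-T_l)\varphi_k^\varepsilon\|\le C\,k^{-1}(\ln k)^{-p}$ for all iteration indices $k$ satisfying $1\le k\le k(\varepsilon,z_\varepsilon)$ (for $k=1$ the right-hand sides are read as $+\infty$).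
   Context: Setting. $\Omega\subset\mathbb{R}^2$ is an open bounded regular set and $\partial\Omega$ is split into $\Gamma_1,\Gamma_2$ with $\Gamma_1\cap\Gamma_2=\emptyset$ and $\overline{\Gamma_1\cup\Gamma_2}=\partial\Omega$. $P u=-\sum_{i,j=1}^2 D_i(a_{i,j}D_ju)$ with coefficients $a_{i,j}\in L_\infty(\Omega)$ such that $\xi^t(a_{i,j}(x))\xi>\alpha\|\xi\|^2$ for a.e. $x\in\Omega$ and all nonzero $\xi\in\mathbb{R}^2$, with $\alpha>0$ independent of $x$. $u_{\nu_A}$ denotes the conormal derivative associated with $P$. Cauchy data $(f,g)\in H^{1/2}(\Gamma_1)\times H^{1/2}_{00}(\Gamma_1)'$ are consistent if there is an $H^1(\Omega)$-solution $u$ (it is then unique) of $Pu=0$ in $\Omega$, $u=f$ and $u_{\nu_A}=g$ at $\Gamma_1$. Operator. Let $\mathcal{H}:=H^{1/2}_{00}(\Gamma_2)'$. Define $L_n:\mathcal{H}\to H^{1/2}(\Gamma_2)$, $L_n(\varphi)=w|_{\Gamma_2}$, where $w\in H^1(\Omega)$ solves $Pw=0$ in $\Omega$, $w=f$ at $\Gamma_1$, $w_{\nu_A}=\varphi$ at $\Gamma_2$; and $L_d:H^{1/2}(\Gamma_2)\to\mathcal{H}$, $L_d(\psi)=v_{\nu_A}|_{\Gamma_2}$, where $v\in H^1(\Omega)$ solves $Pv=0$ in $\Omega$, $v_{\nu_A}=g$ at $\Gamma_1$, $v=\psi$ at $\Gamma_2$. Set $T:=L_d\circ L_n:\mathcal{H}\to\mathcal{H}$.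 $T$ is affine, $T\varphi=T_l\varphi+z_{f,g}$, with linear part $T_l$ (independent of the data) and affine term $z_{f,g}\in\mathcal{H}$. For consistent data the equation $T\varphi=\varphi$ has the unique solution $\bar\varphi=u_{\nu_A}|_{\Gamma_2}$. For any Cauchy data $(f_\varepsilon,g_\varepsilon)\in H^{1/2}(\Gamma_1)\times H^{1/2}_{00}(\Gamma_1)'$, consistent or not, $z_\varepsilon\in\mathcal{H}$ denotes the affine term obtained by the same construction with $(f_\varepsilon,g_\varepsilon)$ in place of $(f,g)$ (if $f_\varepsilon$ is only in $L^2(\Gamma_1)$, it is first replaced by a smoothed version in $H^{1/2}(\Gamma_1)$). Norm. For $\varphi\in\mathcal{H}$ let $W(\varphi)\in H^1(\Omega)$ solve $Pw=0$ in $\Omega$, $w=0$ at $\Gamma_1$, $w_{\nu_A}=\varphi$ at $\Gamma_2$. $\mathcal{H}$ carries the inner product $\langle\varphi,\psi\rangle_*=\int_\Omega\nabla W(\varphi)\cdot\nabla W(\psi)\,dx$; $\|\cdot\|$ denotes the induced norm, which is equivalent to the usual norm of $\mathcal{H}$. It is known that, for this inner product, $T_l$ is self-adjoint, non-negative and non-expansive, and $I-T_l$ is self-adjoint, positive, non-expansive and compact; $F(I-T_l)$ is defined by the functional calculus of self-adjoint operators. *)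

(* Defs.v *)
From HB Require Import structures.
From mathcomp Require Import all_boot all_order all_algebra.
From mathcomp Require Import all_classical all_reals all_analysis.

Set Implicit Arguments.
Unset Strict Implicit.
Unset Printing Implicit Defensive.

Import Order.TTheory GRing.Theory Num.Theory.
Import numFieldNormedType.Exports.

Local Open Scope classical_set_scope.
Local Open Scope ring_scope.

(* The type R * R, with R carrying the Borel sigma-algebra used by
   lebesgue_measure.  Its norm is the sup norm: balls are open squares. *)
Notation plane R := (measurableTypeR R * measurableTypeR R)%type.

Definition leb2 (R : realType) : {measure set (plane R) -> \bar R} :=
  (@lebesgue_measure R \x @lebesgue_measure R)%E.

Section Domain.
Variable R : realType.
Implicit Types (Om G : set (plane R)).

Definition boundary Om : set (plane R) := closure Om `\` Om^°.

(* Lipschitz boundary: near each boundary point and after a rotation, Om is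
   the region above the graph of a Lipschitz function. *)
Definition regular Om := forall x0, boundary Om x0 ->
  exists (c s : R) (gam : R -> R) (L r : R),
    [/\ c ^+ 2 + s ^+ 2 = 1,
        0 < r,
        forall t t', `|gam t - gam t'| <= L * `|t - t'|
      & forall x, ball x0 r x ->
          (Om x <-> gam (c * x.1 + s * x.2) < - s * x.1 + c * x.2)].

Definition boundary_split Om G1 G2 :=
  G1 `&` G2 = set0 /\ closure (G1 `|` G2) = boundary Om.

(* Null sets of the one-dimensional Hausdorff measure, hence of arc length on
   a Lipschitz curve: countable covers by balls of arbitrarily small total
   radius. *)
Definition arc_null G := forall e : R, 0 < e ->
  exists (c : nat -> plane R) (r : nat -> R),
    [/\ forall n, 0 <= r n,
        G `<=` \bigcup_n ball (c n) (r n)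
      & forall n, \sum_(i < n) r i <= e].

Definition axis (i : 'I_2) : plane R := if i == ord0 then (1, 0) else (0, 1).

Definition partial (i : 'I_2) (u : plane R -> R) : plane R -> R :=
  fun x => 'D_(axis i) u x.

Definition smooth (u : plane R -> R) := forall s : seq 'I_2,
  let v := foldr partial u s in
  continuous v /\ forall i x, derivable v x (axis i).

Definition test_function Om (u : plane R -> R) :=
  smooth u /\
  exists K : set (plane R),
    [/\ compact K, K `<=` Om & forall x, ~ K x -> u x = 0].

Definition square_integrable Om (u : plane R -> R) :=
  measurable_fun Om u /\
  (leb2 R).-integrable Om (fun x => (u x ^+ 2)%:E).

End Domain.

(* An element of H^1(Om) is a representative together with its weak gradient
   (unique up to null sets). *)
Record H1 (R : realType) (Om : set (plane R)) := MkH1 {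
  h1_fun :> plane R -> R ;
  grad : 'I_2 -> plane R -> R ;
  h1_fun_sq : square_integrable Om h1_fun ;
  grad_sq : forall i, square_integrable Om (grad i) ;
  grad_weak : forall i (t : plane R -> R), test_function Om t ->
    \int[leb2 R]_(x in Om) (h1_fun x * partial i t x) =
    - \int[leb2 R]_(x in Om) (grad i x * t x) }.

Section BoundaryValues.
Variables (R : realType) (Om : set (plane R)).
Implicit Types (u v : H1 Om) (G : set (plane R)) (h : plane R -> R).

Definition h1_norm u : R :=
  Num.sqrt (\int[leb2 R]_(x in Om) (u x ^+ 2 + \sum_i grad u i x ^+ 2)).

Definition average h (x : plane R) (r : R) : R :=
  (fine (leb2 R (ball x r `&` Om)))^-1 *
  \int[leb2 R]_(y in ball x r `&` Om) h y.

(* "u = h at G" in the sense of traces: on a Lipschitz domain the trace of u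
   is characterized by
     average over (ball x r `&` Om) of |u - (trace u)(x)| --> 0 as r -> 0+
   for arc-length almost every boundary point x. *)
Definition equal_at u G h :=
  arc_null [set x | G x /\
    ~ (average (fun y => `|u y - h x|) x r @[r --> 0^'+] --> (0 : R))].

(* The trace as a total function; its values where the limit does not exist
   (an arc-length null subset of the boundary) are irrelevant. *)
Definition trace u (x : plane R) : R :=
  lim (average u x r @[r --> 0^'+]).

(* H^{1/2}(G): restrictions to G of traces of H^1(Om).  Boundary functions are
   functions on the plane of which only the values on G matter. *)
Definition H12 G h := exists v, equal_at v G h.

(* H^{1/2}_00(G), where G' is the part of the boundary complementary to G:
   the boundary functions on G whose extension by zero to the boundary is a
   trace. *)
Definition H00 G G' h :=
  exists v, equal_at v G h /\ equal_at v G' (fun=> 0).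

(* Elements of H^{1/2}_00(G)', as functionals on boundary functions, continuous
   for the quotient norm of the trace space.  The value 0 outside H00 makes
   equality of functionals the equality of their restrictions to H00. *)
Definition in_H00dual G G' (phi : (plane R -> R) -> R^o) : Prop :=
  [/\ forall (c : R) h1 h2, H00 G G' h1 -> H00 G G' h2 ->
        phi (c *: h1 + h2) = c *: phi h1 + phi h2,
      exists M : R, forall h v,
        equal_at v G h -> equal_at v G' (fun=> 0) ->
        `|phi h| <= M * h1_norm v
    & forall h, ~ H00 G G' h -> phi h = 0].

End BoundaryValues.

Section DualSpace.
Variables (R : realType) (Om G G' : set (plane R)).

Definition H00dual_pred : {pred ((plane R -> R) -> R^o)} :=
  fun phi => `[< in_H00dual Om G G' phi >].

Lemma H00dual_submod_closed : submod_closed H00dual_pred.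
Proof.
have h1_ge0 (v : H1 Om) : 0 <= h1_norm v by exact: sqrtr_ge0.
split.
  apply/asboolP; split => //=.
  - by move=> c h1 h2 _ _; rewrite scaler0 addr0.
  - by exists 0 => h v _ _; rewrite mul0r normr0.
move=> a f g /asboolP[fl [Mf fM] f0] /asboolP[gl [Mg gM] g0].
apply/asboolP; split.
- move=> c h1 h2 H1 H2; rewrite !fctE fl// gl//.
  by rewrite scalerDr !scalerDr addrACA !scalerA [a * c]mulrC.
- exists (`|a| * Mf + Mg) => h v vh v0; rewrite !fctE.
  rewrite (le_trans (ler_normD _ _))// mulrDl lerD ?gM//.
  by rewrite normrM -mulrA ler_wpM2l// fM.
- by move=> h hN; rewrite !fctE f0// g0// scaler0 addr0.
Qed.

HB.instance Definition _ :=
  GRing.isSubmodClosed.Build R ((plane R -> R) -> R^o) H00dual_pred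
    H00dual_submod_closed.

Record H00dual := MkH00dual {
  H00dual_fun :> (plane R -> R) -> R^o ;
  H00dualP : H00dual_fun \in H00dual_pred }.

HB.instance Definition _ := [isSub for H00dual_fun].
HB.instance Definition _ := [Choice of H00dual by <:].
HB.instance Definition _ := [SubChoice_isSubLmodule of H00dual by <:].

End DualSpace.

Section Elliptic.
Variables (R : realType) (Om : set (plane R)).
Variable a : 'I_2 -> 'I_2 -> plane R -> R.

Definition elliptic_coefficients :=
  (forall i j, measurable_fun Om (a i j) /\
     exists M : R, {ae leb2 R, forall x, Om x -> `|a i j x| <= M}) /\
  exists2 alpha : R, 0 < alpha &
    {ae leb2 R, forall x, Om x -> forall xi : 'rV[R]_2, xi != 0 ->
       alpha * \sum_i xi ord0 i ^+ 2 <
       \sum_i \sum_j xi ord0 i * a i j x * xi ord0 j}.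

(* P u = 0 in Om, in the weak sense. *)
Definition weak_solution (u : H1 Om) :=
  forall t : plane R -> R, test_function Om t ->
    \int[leb2 R]_(x in Om)
      (\sum_i \sum_j a i j x * grad u j x * partial i t x) = 0.

(* The conormal derivative of u at G is phi: Green's formula, tested with the
   v in H^1(Om) that vanish on the rest G' of the boundary. *)
Definition conormal (G G' : set (plane R)) (u : H1 Om)
    (phi : H00dual Om G G') :=
  forall v : H1 Om, equal_at v G' (fun=> 0) ->
    \int[leb2 R]_(x in Om)
      (\sum_i \sum_j a i j x * grad u j x * grad v i x) = phi (trace v).

Variables G1 G2 : set (plane R).

Definition consistent (f : plane R -> R) (g : H00dual Om G1 G2) :=
  exists u : H1 Om,
    [/\ weak_solution u, equal_at u G1 f & conormal u g].

Definition is_Ln (f : plane R -> R)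
    (Ln : H00dual Om G2 G1 -> plane R -> R) :=
  forall phi, exists w : H1 Om,
    [/\ weak_solution w, equal_at w G1 f, conormal w phi
      & equal_at w G2 (Ln phi)].

Definition is_Ld (g : H00dual Om G1 G2)
    (Ld : (plane R -> R) -> H00dual Om G2 G1) :=
  forall psi, H12 Om G2 psi -> exists v : H1 Om,
    [/\ weak_solution v, conormal v g, equal_at v G2 psi
      & conormal v (Ld psi)].

(* T = Ld \o Ln for the data (f, g) has linear part Tl and affine term z. *)
Definition affine_splitting (f : plane R -> R) (g : H00dual Om G1 G2)
    (Tl : {linear H00dual Om G2 G1 -> H00dual Om G2 G1})
    (z : H00dual Om G2 G1) :=
  exists Ln Ld, [/\ is_Ln f Ln, is_Ld g Ld
                  & forall phi, Ld (Ln phi) = Tl phi + z].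

Definition is_lifting (W : H00dual Om G2 G1 -> H1 Om) :=
  forall phi,
    [/\ weak_solution (W phi), equal_at (W phi) G1 (fun=> 0)
      & conormal (W phi) phi].

Definition ip_star (W : H00dual Om G2 G1 -> H1 Om)
    (phi psi : H00dual Om G2 G1) : R :=
  \int[leb2 R]_(x in Om) (\sum_i grad (W phi) i x * grad (W psi) i x).

End Elliptic.

Section Operators.
Variables (R : realType) (V : lmodType R) (ip : V -> V -> R).
Implicit Types (A B : V -> V).

Definition ip_norm (x : V) : R := Num.sqrt (ip x x).

Definition self_adjoint A := forall x y, ip (A x) y = ip x (A y).

Definition non_negative A := forall x, 0 <= ip (A x) x.

Definition positive A := forall x, x != 0 -> 0 < ip (A x) x.

Definition non_expansive A := forall x, ip_norm (A x) <= ip_norm x.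

Definition compact_operator A := forall u : nat -> V,
  (exists M : R, forall n, ip_norm (u n) <= M) ->
  exists (s : nat -> nat) (y : V),
    {homo s : m n / (m < n)%N} /\
    (ip_norm (A (u (s n)) - y) @[n --> \oo] --> (0 : R)).

Definition poly_operator (q : {poly R}) A (x : V) : V :=
  \sum_(i < size q) q`_i *: iter i A x.

(* B = F(A), in the continuous functional calculus of a self-adjoint A with
   a I <= A <= b I (so that its spectrum lies in [a, b]): B is the limit in
   operator norm of q_n(A) for polynomials q_n converging to F uniformly on
   [a, b]; B does not depend on the choice of such q_n. *)
Definition functional_calculus (a b : R) (F : R -> R) A B :=
  [/\ self_adjoint A,
      forall x, a * ip x x <= ip (A x) x <= b * ip x x
    & exists q : nat -> {poly R},
        (forall e : R, 0 < e -> \forall n \near \oo,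
           forall t, a <= t <= b -> `|(q n).[t] - F t| <= e) /\
        (forall e : R, 0 < e -> \forall n \near \oo,
           forall x, ip_norm (poly_operator (q n) A x - B x)
                     <= e * ip_norm x)].

End Operators.

Definition log_source (R : realType) (p : R) (lam : R) : R :=
  if 0 < lam then ln (expR 1 * lam^-1) `^ (- p) else 0.

(* Iteration indices start at 1. *)
Definition is_stopping_index (R : realType) (res : nat -> R) (tol : R)
    (K : nat) :=
  [/\ (1 <= K)%N, res K <= tol
    & forall k, (1 <= k)%N -> res k <= tol -> (K <= k)%N].

(* Main.v *)
Require Import Defs.
From HB Require Import structures.
From mathcomp Require Import all_boot all_order all_algebra.
From mathcomp Require Import all_classical all_reals all_analysis.
From mathcomp Require Import measurable_realfun ring lra.
From mathcomp Require Import complex.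
Import Order.TTheory GRing.Theory Num.Theory.
Import numFieldNormedType.Exports.
Local Open Scope classical_set_scope.
Local Open Scope ring_scope.

(** The iteration is [phi_(k+1) = phi_k + r_k], with residual
    [r_k = ze - A phi_k], [A = I - T_l] and [0 <= A <= I].  Put [m = k - 1].  Then

      r_k = A (I - A)^m F(A) psi + (I - A)^m (ze - z),
      || phibar - phi_k || <= || (I - A)^m F(A) psi || + m eps.

    Everything rests on two bounds for the numbers [l] in [[0, 1]]: up to a constant
    depending on [p], [(1 - l)^m F l] is at most [(1 + ln k)^-p], and
    [l (1 - l)^m F l] is at most [k^-1 (1 + ln k)^-p] ([log_filter_le]).  The
    functional calculus transfers them to the operators, and they give the noise-free
    part of both rates.  For the noise, before the stopping index the residual
    exceeds [mu eps] with [mu > 2], while its noise part is at most [eps]; therefore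
    [eps] is itself below the source part of the residual, of order
    [k^-1 (1 + ln k)^-p] ([noise_before_stopping_le]), and the accumulated noise
    [m eps] is of the order of the claimed error ([richardson_log_rate]).

    The transfer needs [|| q(A) || <= sup |q|] on [[0, 1]] for polynomials [q]
    ([poly_operator_norm_le]).  It comes from an algebraic certificate: a polynomial
    that is positive on [[0, 1]] is a sum of squares weighted by [1], [X] and [1 - X]
    ([positive_Qmod]), and each of these weights is a nonnegative operator at [A].

    That [ip_star W] is bilinear is not immediate, because [W] is merely some choice
    of solutions of the mixed boundary value problems; it follows from the uniqueness
    of their gradients, that is, from ellipticity ([lifting_gradient_linear]). *)

Set Implicit Arguments.
Unset Strict Implicit.
Unset Printing Implicit Defensive.

(** * Polynomials that are positive on the unit interval *)

Section PolynomialsPositiveOnTheUnitInterval.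
Variable R : rcfType.
Implicit Types (s r q : {poly R}) (a b c t : R).

(** A complex root of [s] is either real or a root of the quadratic factor that it
    forms with its conjugate; the remainder of [s] by that quadratic has degree at
    most one and a non-real root, so it is zero. *)
Lemma real_or_quadratic_factor s : (1 < size s)%N ->
  (exists c r, s = ('X - c%:P) * r) \/
  (exists a b r, b != 0 /\ s = (('X - a%:P) ^+ 2 + (b ^+ 2)%:P) * r).
Proof.
move=> s1.
have [z] : exists z, root (map_poly (real_complex R) s) z.
  by apply/closed_rootP; rewrite size_map_poly gt_eqF.
case: z => a b.
have [->|b0] := eqVneq b 0.
  rewrite (fmorph_root (real_complex R)) => /factor_theorem[r ->].
  by left; exists a, r; rewrite mulrC.
move=> sz; right; exists a, b.
pose d := ('X - a%:P) ^+ 2 + (b ^+ 2)%:P.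
have dz : (map_poly (real_complex R) d).[Complex a b] = 0.
  rewrite /d rmorphD rmorphXn rmorphB /= map_polyX !map_polyC/= !hornerE.
  by apply/eqP; rewrite eq_complex/=; apply/andP; split; apply/eqP; ring.
have sd : size d = 3%N.
  by rewrite /d size_polyDl size_exp_XsubC// size_polyC; case: (_ != 0).
have d0 : d != 0 by rewrite -size_poly_gt0 sd.
exists (s %/ d); split => //.
have sE := divp_eq s d; set m := s %% d in sE.
suff m0 : m = 0 by rewrite {1}sE m0 addr0 mulrC.
have : (size m < 3)%N by rewrite -sd ltn_modp.
have : (map_poly (real_complex R) m).[Complex a b] = 0.
  move: sz; rewrite sE /root rmorphD rmorphM/= hornerD hornerM dz mulr0 add0r.
  by move=> /eqP.
move=> mz sm.
have mE : m = (m`_1)%:P * 'X + (m`_0)%:P.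
  apply/polyP => -[|[|i]]; rewrite !coefE/= ?mulr1 ?mulr0 ?addr0 ?add0r//.
  by apply: nth_default; move: sm; rewrite ltnS => /leq_trans; apply.
move: mz; rewrite {1}mE rmorphD rmorphM/= map_polyX !map_polyC/= !hornerE.
move=> /eqP; rewrite eq_complex/= => /andP[/eqP h1 /eqP h2].
have m1 : m`_1 = 0.
  apply/eqP; move: h2; rewrite mul0r !addr0 => /eqP.
  by rewrite mulf_eq0 (negbTE b0) orbF.
move: h1; rewrite m1 !mul0r.
by rewrite ?subr0 ?add0r => m0; rewrite mE m1 m0 polyC0 mul0r addr0.
Qed.

Definition interval_weight (w : {poly R}) := [\/ w = 1, w = 'X | w = 1 - 'X].

(** The members are the polynomials whose nonnegativity on [[0, 1]] is witnessed by
    squares, a witness that makes sense for operators as well as for numbers. *)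
Inductive quadratic_module : {poly R} -> Prop :=
| Qmod_gen w r : interval_weight w -> quadratic_module (w * r ^+ 2)
| Qmod_add s q : quadratic_module s -> quadratic_module q ->
    quadratic_module (s + q).

(** The only product of weights that is not again a weight up to a square is
    [X (1 - X)], and [X (1 - X) = X (1 - X)^2 + (1 - X) X^2]. *)
Lemma Qmod_mul s q :
  quadratic_module s -> quadratic_module q -> quadratic_module (s * q).
Proof.
move=> ms mq; elim: ms => [w r hw|s1 s2 _ h1 _ h2]; last first.
  by rewrite mulrDl; exact: Qmod_add.
elim: mq => [v u hv|s1 s2 _ h1 _ h2]; last by rewrite mulrDr; exact: Qmod_add.
have w1 : interval_weight 1 by constructor 1.
have wX : interval_weight 'X by constructor 2.
have wY : interval_weight (1 - 'X) by constructor 3.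
have mixed : quadratic_module ('X * (1 - 'X) * (r * u) ^+ 2).
  have -> : 'X * (1 - 'X) * (r * u) ^+ 2 =
    'X * ((1 - 'X) * (r * u)) ^+ 2 + (1 - 'X) * ('X * (r * u)) ^+ 2 by ring.
  by apply: Qmod_add; exact: Qmod_gen.
case: hw => ->; case: hv => ->.
- suff -> : 1 * r ^+ 2 * (1 * u ^+ 2) = 1 * (r * u) ^+ 2 by exact: Qmod_gen.
  by ring.
- suff -> : 1 * r ^+ 2 * ('X * u ^+ 2) = 'X * (r * u) ^+ 2 by exact: Qmod_gen.
  by ring.
- suff -> : 1 * r ^+ 2 * ((1 - 'X) * u ^+ 2) = (1 - 'X) * (r * u) ^+ 2.
    exact: Qmod_gen.
  by ring.
- suff -> : 'X * r ^+ 2 * (1 * u ^+ 2) = 'X * (r * u) ^+ 2 by exact: Qmod_gen.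
  by ring.
- suff -> : 'X * r ^+ 2 * ('X * u ^+ 2) = 1 * ('X * r * u) ^+ 2.
    exact: Qmod_gen.
  by ring.
- suff -> : 'X * r ^+ 2 * ((1 - 'X) * u ^+ 2) =
    'X * (1 - 'X) * (r * u) ^+ 2 by [].
  by ring.
- suff -> : (1 - 'X) * r ^+ 2 * (1 * u ^+ 2) = (1 - 'X) * (r * u) ^+ 2.
    exact: Qmod_gen.
  by ring.
- suff -> : (1 - 'X) * r ^+ 2 * ('X * u ^+ 2) =
    'X * (1 - 'X) * (r * u) ^+ 2 by [].
  by ring.
- suff -> : (1 - 'X) * r ^+ 2 * ((1 - 'X) * u ^+ 2) =
    1 * ((1 - 'X) * r * u) ^+ 2 by exact: Qmod_gen.
  by ring.
Qed.

Lemma Qmod_sqr q : quadratic_module (q ^+ 2).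
Proof. by rewrite -[q ^+ 2]mul1r; apply: Qmod_gen; constructor 1. Qed.

Lemma Qmod_const c : 0 <= c -> quadratic_module c%:P.
Proof.
by move=> c0; rewrite -(sqr_sqrtr c0) rmorphXn; exact: Qmod_sqr.
Qed.

(** Every factor of [s] can be given a sign that makes it a member: a quadratic
    factor is a sum of two squares, a root [c < 0] gives [X + (- c)] and a root
    [c > 1] gives [(1 - X) + (c - 1)].  Strict positivity excludes the roots in
    [[0, 1]]. *)
Lemma positive_Qmod s :
  (forall t, 0 <= t <= 1 -> 0 < s.[t]) -> quadratic_module s.
Proof.
have [n] := ubnP (size s); elim: n s => // n IH s sn s_gt0.
have s0 : s != 0.
  apply/eqP => s0; have := s_gt0 0; rewrite s0 horner0 ltxx lexx ler01.
  by move=> /(_ erefl).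
have [s1|] := leqP (size s) 1.
  move: (s_gt0 0); rewrite (size1_polyC s1) hornerC lexx ler01 => /(_ erefl).
  by move=> /ltW; exact: Qmod_const.
have size_lt d r : s = d * r -> (1 < size d)%N -> (size r < n)%N.
  move=> sE d1.
  have [d0 r0] : d != 0 /\ r != 0.
    by apply/andP; rewrite -negb_or -mulf_eq0 -sE.
  move: sn; rewrite sE size_mul// => sn.
  move: sn d1; case: (size d) => [//|[//|k]] + _.
  by rewrite !addSn/= ltnS; apply: leq_ltn_trans; exact: leq_addl.
move=> /real_or_quadratic_factor[[c [r sE]]|[a [b [r [b0 sE]]]]]; last first.
  have d_gt0 t : 0 < (('X - a%:P) ^+ 2 + (b ^+ 2)%:P).[t].
    rewrite !hornerE; apply: ltr_wpDl; first exact: sqr_ge0.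
    by rewrite exprn_even_gt0.
  rewrite sE; apply: Qmod_mul.
    apply: Qmod_add; first exact: Qmod_sqr.
    by apply: Qmod_const; exact: sqr_ge0.
  apply: IH.
    apply: size_lt sE _.
    by rewrite size_polyDl size_exp_XsubC// size_polyC; case: (_ != 0).
  by move=> t /s_gt0; rewrite sE hornerM pmulr_rgt0.
have [c_lt0|c_ge0] := ltP c 0.
  rewrite sE; apply: Qmod_mul.
    rewrite -polyCN; apply: Qmod_add.
      rewrite -['X]mulr1 -(expr1n _ 2); apply: Qmod_gen.
      by constructor 2.
    by apply: Qmod_const; lra.
  apply: IH; first by apply: size_lt sE _; rewrite size_XsubC.
  move=> t t01; move: (s_gt0 t t01); rewrite sE hornerM pmulr_rgt0// !hornerE.
  by lra.
have [c_gt1|c_le1] := ltP 1 c; last first.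
  move: (s_gt0 c); rewrite c_ge0 c_le1 => /(_ erefl).
  by rewrite sE !hornerE subrr mul0r ltxx.
have sE' : s = (c%:P - 'X) * (- r) by rewrite sE; ring.
rewrite sE'; apply: Qmod_mul.
  have -> : c%:P - 'X = (1 - 'X) * 1 ^+ 2 + (c - 1)%:P :> {poly R}.
    by rewrite rmorphB; ring.
  apply: Qmod_add; first by apply: Qmod_gen; constructor 3.
  by apply: Qmod_const; lra.
apply: IH.
  by rewrite size_polyN; apply: size_lt sE _; rewrite size_XsubC.
move=> t t01; move: (s_gt0 t t01); rewrite sE' hornerM pmulr_rgt0// !hornerE.
by lra.
Qed.

End PolynomialsPositiveOnTheUnitInterval.

(** * Semi-inner products *)

Record semi_inner_product (R : realType) (V : lmodType R) (ip : V -> V -> R) :=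
  SemiInnerProduct {
  sip_linear : forall c x y z, ip (c *: x + y) z = c * ip x z + ip y z ;
  sip_sym : forall x y, ip x y = ip y x ;
  sip_ge0 : forall x, 0 <= ip x x }.

Section SemiInnerProductNorm.
Variables (R : realType) (V : lmodType R) (ip : V -> V -> R).
Hypothesis ipP : semi_inner_product ip.
Local Notation nrm := (ip_norm ip).

Lemma sipDl x y z : ip (x + y) z = ip x z + ip y z.
Proof. by rewrite -[x]scale1r (sip_linear ipP) mul1r scale1r. Qed.

Lemma sip0l z : ip 0 z = 0.
Proof. by have := sipDl 0 0 z; rewrite addr0; lra. Qed.

Lemma sipZl c x z : ip (c *: x) z = c * ip x z.
Proof. by rewrite -[c *: x]addr0 (sip_linear ipP) sip0l addr0. Qed.

Lemma sipDr x y z : ip x (y + z) = ip x y + ip x z.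
Proof. by rewrite (sip_sym ipP) sipDl !(sip_sym ipP x). Qed.

Lemma sipZr c x z : ip x (c *: z) = c * ip x z.
Proof. by rewrite (sip_sym ipP) sipZl (sip_sym ipP x). Qed.

Lemma sip_norm_sqr x : nrm x ^+ 2 = ip x x.
Proof. by rewrite sqr_sqrtr// (sip_ge0 ipP). Qed.

Lemma sip_norm_ge0 x : 0 <= nrm x. Proof. exact: sqrtr_ge0. Qed.

Lemma sip_CauchySchwarz x y : ip x y <= nrm x * nrm y.
Proof.
suff h : ip x y ^+ 2 <= (nrm x * nrm y) ^+ 2.
  rewrite (le_trans (ler_norm _))// -(ler_pXn2r (n := 2))// ?nnegrE//.
    by rewrite -normrX ger0_norm// sqr_ge0.
  by rewrite mulr_ge0// sip_norm_ge0.
rewrite exprMn !sip_norm_sqr.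
have q t : 0 <= t ^+ 2 * ip x x + 2 * t * ip x y + ip y y.
  have := sip_ge0 ipP (t *: x + y).
  rewrite !(sipDl, sipDr, sipZl, sipZr) (sip_sym ipP y x).
  move=> /le_trans; apply; rewrite le_eqVlt; apply/orP; left.
  by apply/eqP; ring.
have [x0|x0] := eqVneq (ip x x) 0.
  (* an affine function of t that stays nonnegative is constant *)
  have [->|b0] := eqVneq (ip x y) 0; first by rewrite expr0n/= x0 mul0r.
  (* at this t the affine function takes the value -1 *)
  have := q (- (ip y y + 1) / (2 * ip x y)).
  rewrite x0 mulr0 add0r.
  have -> : 2 * (- (ip y y + 1) / (2 * ip x y)) * ip x y = - (ip y y + 1).
    by field.
  by lra.
have xp : 0 < ip x x by rewrite lt_neqAle eq_sym x0 (sip_ge0 ipP).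
(* the minimum of the quadratic function of t *)
have := q (- ip x y / ip x x).
have -> : (- ip x y / ip x x) ^+ 2 * ip x x + 2 * (- ip x y / ip x x) * ip x y
    + ip y y = (ip x x * ip y y - ip x y ^+ 2) / ip x x by field.
by rewrite pmulr_lge0 ?invr_gt0// subr_ge0.
Qed.

Lemma sip_normD x y : nrm (x + y) <= nrm x + nrm y.
Proof.
rewrite -(ler_pXn2r (n := 2))// ?nnegrE ?addr_ge0 ?sip_norm_ge0//.
rewrite sqrrD !sip_norm_sqr !(sipDl, sipDr) (sip_sym ipP y x).
by have := sip_CauchySchwarz x y; lra.
Qed.

Lemma sip_normZ c x : nrm (c *: x) = `|c| * nrm x.
Proof.
rewrite /ip_norm sipZl sipZr mulrA -expr2 sqrtrM ?sqr_ge0//.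
by rewrite sqrtr_sqr.
Qed.

Lemma sip_norm0 : nrm 0 = 0.
Proof. by rewrite /ip_norm sip0l sqrtr0. Qed.

Lemma sip_normN x : nrm (- x) = nrm x.
Proof. by rewrite -scaleN1r sip_normZ normrN normr1 mul1r. Qed.

Lemma sip_normB x y : nrm (x - y) <= nrm x + nrm y.
Proof. by rewrite -(sip_normN y) sip_normD. Qed.

End SemiInnerProductNorm.

(** * Polynomials and continuous functions of a self-adjoint operator *)

Section PolynomialCalculus.
Variables (R : realType) (V : lmodType R) (A : {linear V -> V}).
Implicit Types (p q : {poly R}) (x y : V).
Local Notation op q := (poly_operator q A).

(** The sum defining [poly_operator] stops at [size q]; a common longer range is
    what makes two polynomials of different degrees comparable. *)
Lemma poly_operator_widen n q x : (size q <= n)%N ->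
  op q x = \sum_(i < n) q`_i *: iter i A x.
Proof.
move=> qn; rewrite /poly_operator.
rewrite (big_ord_widen n (fun i => q`_i *: iter i A x) qn) big_mkcond/=.
apply: eq_bigr => i _; case: ltnP => // qi.
by rewrite nth_default// scale0r.
Qed.

Lemma poly_operatorD p q x : op (p + q) x = op p x + op q x.
Proof.
pose n := maxn (size p) (size q).
rewrite (@poly_operator_widen n (p + q)) ?size_polyD//.
rewrite (@poly_operator_widen n p) ?leq_maxl//.
rewrite (@poly_operator_widen n q) ?leq_maxr// -big_split/=.
by apply: eq_bigr => i _; rewrite coefD scalerDl.
Qed.

Lemma poly_operatorC c x : op (c%:P) x = c *: x.
Proof.
rewrite (@poly_operator_widen 1) ?size_polyC ?leq_b1//.
by rewrite big_ord1 coefC.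
Qed.

Lemma poly_operatorMX q x : op (q * 'X) x = op q (A x).
Proof.
rewrite (@poly_operator_widen (size q).+1).
  rewrite big_ord_recl coefMX scale0r add0r; apply: eq_bigr => i _.
  by rewrite coefMX/= -iterSr.
by rewrite (leq_trans (size_polyMleq _ _))// size_polyX addn2.
Qed.

Lemma poly_operatorX x : op 'X x = A x.
Proof.
rewrite -[X in poly_operator X]mul1r poly_operatorMX poly_operatorC.
by rewrite scale1r.
Qed.

Lemma poly_operator_linear q c x y : op q (c *: x + y) = c *: op q x + op q y.
Proof.
elim/poly_ind: q x y => [|q b IH] x y.
  by rewrite -polyC0 !poly_operatorC !scale0r scaler0 addr0.
rewrite !poly_operatorD !poly_operatorMX !poly_operatorC linearP IH.
by rewrite !scalerDr addrACA !scalerA [b * c]mulrC.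
Qed.

Lemma poly_operatorDr q x y : op q (x + y) = op q x + op q y.
Proof. by rewrite -[x in LHS]scale1r poly_operator_linear scale1r. Qed.

Lemma poly_operator_comm q x : op q (A x) = A (op q x).
Proof.
elim/poly_ind: q x => [|q b IH] x.
  by rewrite -polyC0 !poly_operatorC !scale0r linear0.
rewrite !poly_operatorD !poly_operatorMX !poly_operatorC IH.
by rewrite linearD linearZ.
Qed.

Lemma poly_operatorZ c q x : op (c%:P * q) x = c *: op q x.
Proof.
rewrite mul_polyC (@poly_operator_widen (size q)) ?size_scale_leq//.
rewrite scaler_sumr; apply: eq_bigr => i _; by rewrite coefZ scalerA.
Qed.

Lemma poly_operatorM p q x : op (p * q) x = op p (op q x).
Proof.
elim/poly_ind: p x => [|p b IH] x.
  by rewrite mul0r -polyC0 !poly_operatorC !scale0r.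
rewrite mulrDl !poly_operatorD poly_operatorZ poly_operatorC.
by rewrite -mulrA ['X * q]mulrC mulrA !poly_operatorMX IH poly_operator_comm.
Qed.

Lemma poly_operatorN q x : op (- q) x = - op q x.
Proof. by rewrite -mulN1r -polyCN poly_operatorZ scaleN1r. Qed.

Section SpectralBound.
Variable ip : V -> V -> R.
Hypotheses (ipP : semi_inner_product ip) (A_sa : self_adjoint ip A).
Hypothesis A01 : forall x, 0 <= ip (A x) x <= ip x x.
Local Notation nrm := (ip_norm ip).

Lemma poly_operator_self_adjoint q : self_adjoint ip (poly_operator q A).
Proof.
elim/poly_ind: q => [|q b IH] x y.
  by rewrite -polyC0 !poly_operatorC !scale0r sip0l// (sip_sym ipP) sip0l.
rewrite !poly_operatorD !poly_operatorMX !poly_operatorC.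
rewrite (sipDl ipP) (sipDr ipP) (sipZl ipP) (sipZr ipP) IH A_sa.
by rewrite -poly_operator_comm.
Qed.

(** For a generator [w r^2], self-adjointness turns the form of [(w r^2)(A)] at
    [x] into the form of [w(A)] at [r(A) x]; for the three weights this is the
    form of the identity, of [A] and of [1 - A]. *)
Lemma Qmod_operator_ge0 s x : quadratic_module s -> 0 <= ip (op s x) x.
Proof.
elim=> [w r hw|p q _ p0 _ q0]; last first.
  by rewrite poly_operatorD (sipDl ipP) addr_ge0.
have -> : w * r ^+ 2 = r * (w * r) by ring.
rewrite poly_operatorM poly_operator_self_adjoint poly_operatorM.
move: (op r x) => y; case: hw => ->.
- by rewrite poly_operatorC scale1r (sip_ge0 ipP).
- by rewrite poly_operatorX; case/andP: (A01 y).
- rewrite poly_operatorD poly_operatorN poly_operatorX poly_operatorC scale1r.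
  by rewrite (sipDl ipP) -scaleN1r (sipZl ipP); have := A01 y; lra.
Qed.

(** The spectral bound [||q(A)|| <= sup |q|]: [M^2 - q^2] is positive on [[0, 1]],
    hence in the quadratic module, hence [M^2 - q(A)^2] is a nonnegative
    operator. *)
Lemma poly_operator_norm_le q (M : R) x : 0 <= M ->
  (forall t : R, 0 <= t <= 1 -> `|q.[t]| < M) -> nrm (op q x) <= M * nrm x.
Proof.
move=> M0 qM.
rewrite -(ler_pXn2r (n := 2))// ?nnegrE ?mulr_ge0 ?sip_norm_ge0//.
rewrite exprMn !(sip_norm_sqr ipP).
have : quadratic_module ((M ^+ 2)%:P - q * q).
  apply: positive_Qmod => t /qM; rewrite !hornerE subr_gt0 -expr2 => h.
  by rewrite -(real_normK (num_real q.[t])) ltr_pXn2r// nnegrE.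
move=> /(Qmod_operator_ge0 x).
rewrite poly_operatorD poly_operatorN poly_operatorC poly_operatorM.
rewrite (sipDl ipP) -scaleN1r !(sipZl ipP) poly_operator_self_adjoint.
by rewrite mulN1r subr_ge0.
Qed.

(** If [q] approximates [F] uniformly and [q(A)] approximates [B] in norm, then
    [r(A) B] is close to [(r q)(A)], whose norm the previous bound controls by
    [sup |r q|], which is close to [sup |r F|]. *)
Lemma functional_calculus_norm_le (F : R -> R) (B : V -> V) r (M : R) x :
  functional_calculus ip 0 1 F A B ->
  (forall t : R, 0 <= t <= 1 -> `|r.[t] * F t| <= M) ->
  nrm (op r (B x)) <= M * nrm x.
Proof.
move=> [_ _ [q [qF qB]]] rM.
(* a crude bound of r, to absorb the two approximation errors *)
have [N N_gt0 rN] :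
    exists2 N, 0 < N & forall t : R, 0 <= t <= 1 -> `|r.[t]| < N.
  exists (1 + \sum_(i < size r) `|r`_i|).
    by rewrite ltr_pwDl// sumr_ge0.
  move=> t /andP[t0 t1]; rewrite horner_coef.
  apply: (@le_lt_trans _ _ (\sum_(i < size r) `|r`_i|)); last by rewrite ltrDr.
  rewrite (le_trans (ler_norm_sum _ _ _))//; apply: ler_sum => i _.
  by rewrite normrM ler_piMr// ger0_norm ?exprn_ge0// exprn_ile1.
have M0 : 0 <= M by rewrite (le_trans _ (rM 0 _))// lexx ler01.
apply/ler_addgt0Pr => e e0.
(* N d + d bounds the first error and N d the second one *)
pose d := e / (N + N + 1) / (nrm x + 1).
have x1 : 0 < nrm x + 1 by rewrite ltr_wpDl ?sip_norm_ge0.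
have N1 : 0 < N + N + 1 by lra.
have d0 : 0 < d by rewrite !divr_gt0.
have [n [qFn qBn]] := filter_ex (filterI (qF d d0) (qB d d0)).
have -> : B x = op (q n) x - (op (q n) x - B x)
  by rewrite opprB addrCA subrr addr0.
rewrite poly_operatorDr -scaleN1r (le_trans (sip_normD ipP _ _))//.
have h1 : nrm (op r (op (q n) x)) <= (M + N * d + d) * nrm x.
  rewrite -poly_operatorM; apply: poly_operator_norm_le => [|t t01].
    by apply: addr_ge0; [apply: addr_ge0 => //; apply: mulr_ge0|]; exact: ltW.
  rewrite hornerM -[(q n).[t]](subrK (F t)) addrC mulrDr.
  rewrite -addrA (le_lt_trans (ler_normD _ _))// ler_ltD ?rM//.
  rewrite normrM ltr_pwDr// ler_pM// ?qFn//.
  exact/ltW/rN.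
have h2 : nrm (op r (-1 *: (op (q n) x - B x))) <= N * d * nrm x.
  rewrite (le_trans (poly_operator_norm_le _ (ltW N_gt0) rN))//.
  by rewrite (sip_normZ ipP) normrN normr1 mul1r -mulrA ler_pM2l.
apply: (le_trans (lerD h1 h2)).
have -> : (M + N * d + d) * nrm x + N * d * nrm x =
  M * nrm x + e * (nrm x / (nrm x + 1)).
  by rewrite /d; field; rewrite ?gt_eqF.
by rewrite lerD2l ler_piMr ?(ltW e0)// ler_pdivrMr// mul1r lerDl.
Qed.

End SpectralBound.
End PolynomialCalculus.

(** * The logarithmic source function against powers of 1 - lambda *)

Section LogarithmicFilterBounds.
Variable R : realType.
Implicit Types (l p q u k : R).

(** [v <= exp v] at [v = u / q], raised to the power [q]. *)
Lemma powR_le_expR q u : 0 < q -> 0 <= u -> u `^ q <= q `^ q * expR u.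
Proof.
move=> q0 u0; have -> : u = q * (u / q) by field; rewrite gt_eqF.
have uq0 : 0 <= u / q by rewrite divr_ge0// ltW.
rewrite powRM ?(ltW q0)// ler_wpM2l ?powR_ge0//.
rewrite [q * _]mulrC expRM ge0_ler_powR ?nnegrE ?expR_ge0 ?(ltW q0)//.
by rewrite (le_trans _ (expR_ge1Dx _))// lerDr.
Qed.

(** With [x = l * (m + 1)] one has [(1 - l)^m <= exp (l - x) <= e * exp (- x)].
    For [x <= 1] the trivial bound 1 is what the maximum gives. *)
Lemma damping_le_expR l m : 0 <= l <= 1 ->
  (1 - l) ^+ m <= expR 1 * expR (- Num.max 1 (l * m.+1%:R)).
Proof.
move=> /andP[l0 l1]; rewrite -expRD.
have [lm1|_] := leP (l * m.+1%:R) 1.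
  by rewrite subrr expR0 exprn_ile1// ?subr_ge0// gerBl.
apply: (@le_trans _ _ (expR (- l) ^+ m)).
  by rewrite lerXn2r ?nnegrE ?expR_ge0 ?subr_ge0// expR_ge1Dx.
by rewrite -expRM_natl ler_expR -natr1; lra.
Qed.

Lemma log_source_ge0 p l : 0 <= log_source p l.
Proof. by rewrite /log_source; case: ifP => // _; exact: powR_ge0. Qed.

(** Since [ln k = ln (l k) - ln l] and [ln u <= u - 1], the quantity [1 + ln k] is
    at most [u * (1 - ln l)] with [u = max 1 (l k)]; raise this to the power [-p].
    So [F l] is of the order [(1 + ln k)^-p] up to a power of [l k]. *)
Lemma log_source_le p l k : 0 <= p -> 0 < l <= 1 -> 1 <= k ->
  log_source p l <= Num.max 1 (l * k) `^ p * (1 + ln k) `^ (- p).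
Proof.
move=> p0 /andP[l0 l1] k1; set u := Num.max _ _; rewrite /log_source l0.
have k0 : 0 < k by exact: lt_le_trans k1.
have lnk0 : 0 <= ln k by exact: ln_ge0.
have -> : ln (expR 1 * l^-1) = 1 - ln l.
  by rewrite ln_div ?posrE ?expR_gt0// expRK.
have lnl0 : ln l <= 0 by exact: ln_le0.
have u1 : 1 <= u by rewrite le_max lexx.
have lnlk : ln (l * k) = ln l + ln k by rewrite lnM ?posrE.
have main : 1 + ln k <= u * (1 - ln l).
  have [lk1|lk1] := leP (l * k) 1.
    have : ln (l * k) <= 0 by exact: ln_le0.
    rewrite /u max_l//; lra.
  have : ln (1 + (l * k - 1)) <= l * k - 1.
    by apply: le_ln1Dx; have := mulr_gt0 l0 k0; lra.
  rewrite addrC subrK lnlk; have uE : u = l * k by rewrite /u max_r// ltW.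
  by move: u1; rewrite uE; nra.
rewrite !powRN ler_pdivlMr ?powR_gt0//; last by lra.
rewrite mulrC ler_pdivrMr ?powR_gt0//; last by lra.
have [u0 a0] : 0 <= u /\ 0 <= 1 - ln l by lra.
rewrite -powRM//.
by apply: ge0_ler_powR => //; rewrite nnegrE; nra.
Qed.

Definition log_filter_const p : R := expR 1 * (p + 1) `^ (p + 1).

Lemma log_filter_const_ge0 p : 0 <= log_filter_const p.
Proof. by rewrite mulr_ge0 ?expR_ge0 ?powR_ge0. Qed.

(** Both filter bounds at once: as [max 1 (l (m + 1))] dominates 1 it bounds
    [(1 - l)^m F], and as it dominates [l (m + 1)] it bounds [l (1 - l)^m F] with
    an additional decay [1 / (m + 1)].  The exponential decay of the damping
    absorbs the power [u ^ (p + 1)]. *)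
Lemma log_filter_le p l m : 0 <= p -> 0 <= l <= 1 ->
  Num.max 1 (l * m.+1%:R) * ((1 - l) ^+ m * log_source p l) <=
  log_filter_const p * (1 + ln m.+1%:R) `^ (- p).
Proof.
move=> p0 /andP[l0 l1].
have rhs0 : 0 <= log_filter_const p * (1 + ln m.+1%:R) `^ (- p).
  by rewrite mulr_ge0 ?powR_ge0 ?log_filter_const_ge0.
have [->|l_neq0] := eqVneq l 0; first by rewrite /log_source ltxx !mulr0.
have lp : 0 < l by rewrite lt_neqAle eq_sym l_neq0.
have k1 : 1 <= m.+1%:R :> R by rewrite ler1n.
have l01 : 0 < l <= 1 by rewrite lp.
have h1 := log_source_le p0 l01 k1.
have h2 : (1 - l) ^+ m <= expR 1 * expR (- Num.max 1 (l * m.+1%:R)).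
  by apply: damping_le_expR; rewrite l0.
move: h1 h2; set u := Num.max _ _; set K := (1 + _) `^ _ => h1 h2.
have u1 : 1 <= u by rewrite le_max lexx.
have u0 : 0 <= u by exact: le_trans u1.
have p1 : 0 < p + 1 by lra.
have K0 : 0 <= K by exact: powR_ge0.
have h3 : u * u `^ p <= (p + 1) `^ (p + 1) * expR u.
  apply: le_trans (powR_le_expR p1 u0).
  rewrite -[u in u * _](powRr1 u0) -powRD ?[1 + p]addrC//.
  by rewrite (gt_eqF (lt_le_trans ltr01 u1)) implybT.
have h4 : (1 - l) ^+ m * log_source p l <=
    expR 1 * expR (- u) * (u `^ p * K).
  by rewrite ler_pM// ?log_source_ge0// exprn_ge0// subr_ge0.
apply: (le_trans (ler_wpM2l u0 h4)).
have -> : u * (expR 1 * expR (- u) * (u `^ p * K)) =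
   expR 1 * K * (expR (- u) * (u * u `^ p)) by ring.
have -> : log_filter_const p * K =
   expR 1 * K * (expR (- u) * ((p + 1) `^ (p + 1) * expR u)).
  rewrite /log_filter_const expRN; field.
  by rewrite gt_eqF// expR_gt0.
by rewrite ler_wpM2l ?mulr_ge0 ?expR_ge0// ler_wpM2l ?expR_ge0.
Qed.

End LogarithmicFilterBounds.

(** * Richardson iteration with noisy data under the discrepancy principle *)

Section LogarithmicConvergenceRate.
Variables (R : realType) (V : lmodType R) (ip : V -> V -> R).
Variable A : {linear V -> V}.
Local Notation nrm := (ip_norm ip).
Local Notation op q := (poly_operator q A).
Hypotheses (ipP : semi_inner_product ip) (A_sa : self_adjoint ip A).
Hypothesis A01 : forall x, 0 <= ip (A x) x <= ip x x.
Hypothesis T_le : forall x, nrm (x - A x) <= nrm x.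

Lemma damping_operatorS m x :
  op ((1 - 'X) ^+ m.+1) x = op ((1 - 'X) ^+ m) x - A (op ((1 - 'X) ^+ m) x).
Proof.
rewrite exprS poly_operatorM poly_operatorD poly_operatorN poly_operatorX.
by rewrite poly_operatorC scale1r.
Qed.

Lemma damping_operator_le m x : nrm (op ((1 - 'X) ^+ m) x) <= nrm x.
Proof.
elim: m => [|m IH]; first by rewrite poly_operatorC scale1r.
by rewrite damping_operatorS (le_trans (T_le _)).
Qed.

Variables (phi : nat -> V) (z ze phibar : V) (eps : R).
Hypotheses (Aphibar : A phibar = z) (ze_z : nrm (ze - z) <= eps).
Hypothesis phiS :
  forall k, (1 <= k)%N -> phi k.+1 = phi k - A (phi k) + ze.

(** The step is [phi + r], where [r] is the residual, so the residual evolves by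
    [r - A r]: the noise in it is damped and never amplified. *)
Lemma richardson_residual m :
  ze - A (phi m.+1) =
  op ((1 - 'X) ^+ m) (A (phibar - phi 1%N)) + op ((1 - 'X) ^+ m) (ze - z).
Proof.
elim: m => [|m IH].
  by rewrite !poly_operatorC !scale1r linearB/= Aphibar [RHS]addrC addrA subrK.
rewrite phiS// !damping_operatorS addrACA -opprD -linearD/= -IH.
by rewrite linearD !linearB/= !opprD !opprK !addrA [RHS](ACl (1*2*4*3)).
Qed.

(** Each step adds one copy of the noise to the error and damps what was there
    before. *)
Lemma richardson_error m :
  nrm (phibar - phi m.+1 - op ((1 - 'X) ^+ m) (phibar - phi 1%N))
    <= m%:R * eps.
Proof.
elim: m => [|m IH].
  by rewrite poly_operatorC scale1r subrr (sip_norm0 ipP) mul0r.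
rewrite phiS// damping_operatorS.
set d := op _ _ in IH *; set e := phi m.+1 in IH *.
have -> : phibar - (e - A e + ze) - (d - A d) =
    (phibar - e - d) - A (phibar - e - d) - (ze - z).
  rewrite !linearB/= Aphibar !opprD !opprK !addrA.
  by rewrite [RHS](ACl (1*2*5*7*3*6*4*8)) /= subrK.
rewrite (le_trans (sip_normB ipP _ _))// -natr1 mulrDl mul1r lerD//.
exact: le_trans (T_le _) IH.
Qed.

Variables (p mu : R) (B : V -> V) (psi : V) (K : nat).
Hypotheses (p0 : 0 <= p) (mu2 : 2 < mu) (eps0 : 0 < eps).
Hypothesis BF : functional_calculus ip 0 1 (log_source p) A B.
Hypothesis source : phibar - phi 1%N = B psi.
Hypothesis stop :
  is_stopping_index (fun k => nrm (ze - A (phi k))) (mu * eps) K.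

(* m + 1 is the index of the iterate *)
Let lrate m := log_filter_const p * (1 + ln m.+1%:R) `^ (- p).

Lemma damped_source_le m :
  nrm (op ((1 - 'X) ^+ m) (B psi)) <= lrate m * nrm psi.
Proof.
apply: (functional_calculus_norm_le ipP A_sa A01 _ BF) => t t01.
have -> : ((1 - 'X) ^+ m).[t] = (1 - t) ^+ m by rewrite !hornerE.
rewrite ger0_norm; last first.
  rewrite mulr_ge0 ?log_source_ge0// exprn_ge0// subr_ge0.
  by case/andP: t01.
apply: le_trans (log_filter_le m p0 t01).
rewrite ler_peMl ?le_max ?lexx// mulr_ge0 ?log_source_ge0// exprn_ge0//.
by rewrite subr_ge0; case/andP: t01.
Qed.

Lemma damped_source_residual_le m :
  nrm (op ((1 - 'X) ^+ m) (A (B psi))) <= m.+1%:R^-1 * lrate m * nrm psi.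
Proof.
rewrite -poly_operatorMX.
apply: (functional_calculus_norm_le ipP A_sa A01 _ BF) => t t01.
have [t0 t1] : 0 <= t /\ 0 <= 1 - t by move: t01 => /andP[]; lra.
have f0 : 0 <= (1 - t) ^+ m * log_source p t.
  by rewrite mulr_ge0 ?log_source_ge0// exprn_ge0.
have -> : ((1 - 'X) ^+ m * 'X).[t] = (1 - t) ^+ m * t by rewrite !hornerE.
rewrite ger0_norm; last by rewrite mulrAC mulr_ge0.
rewrite -mulrA.
rewrite ler_pdivlMl//; apply: le_trans (log_filter_le m p0 t01).
rewrite [leLHS](_ : _ = t * m.+1%:R * ((1 - t) ^+ m * log_source p t));
  last by ring.
by rewrite ler_wpM2r// le_max lexx orbT.
Qed.

(** Before the stopping index the residual exceeds [mu * eps], while its noise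
    part is at most [eps]; as [mu > 2], its source part exceeds [eps].  This bounds
    the noise level by a quantity independent of [mu]. *)
Lemma noise_before_stopping_le m : (m.+1 < K)%N ->
  eps <= m.+1%:R^-1 * lrate m * nrm psi.
Proof.
move=> mK; have [_ _ Kmin] := stop.
have : mu * eps < nrm (ze - A (phi m.+1)).
  by rewrite ltNge; apply/negP => /(Kmin m.+1 isT); rewrite leqNgt mK.
rewrite richardson_residual source => /lt_le_trans /(_ (sip_normD ipP _ _)).
move=> /lt_le_trans/(_ (lerD (damped_source_residual_le m)
  (le_trans (damping_operator_le m _) ze_z))) => h.
rewrite -(lerD2r eps) (le_trans _ (ltW h))//.
by rewrite -mulr2n -mulr_natl ler_pM2r// ltW.
Qed.

(** The noise level is bounded at the index [k - 1], which precedes the stopping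
    index even when [k] is that index.  Passing from [k - 1] to [k] costs a factor 2
    in the reciprocal and, in the logarithm, only the summand 1 that the filter
    bounds carry. *)
Theorem richardson_log_rate k : (1 < k <= K)%N ->
  let C := 3 * log_filter_const p * nrm psi in
  nrm (phibar - phi k) <= C * ln k%:R `^ (- p) /\
  nrm (ze - A (phi k)) <= C * (k%:R^-1 * ln k%:R `^ (- p)).
Proof.
case: k => [|[|m]]// /andP[_ mK] C.
set k := m.+2.
have noise := noise_before_stopping_le mK.
have lnk0 : 0 < ln (k%:R : R) by rewrite ln_gt0// ltr1n.
set r := ln k%:R `^ (- p).
have powRN_anti (u v : R) : 0 < u -> u <= v -> v `^ (- p) <= u `^ (- p).
  move=> u0 uv; rewrite !powRN lef_pV2 ?posrE ?powR_gt0 ?(lt_le_trans u0)//.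
  by rewrite ge0_ler_powR// nnegrE ltW// (lt_le_trans u0).
have now : (1 + ln k%:R) `^ (- p) <= r by apply: powRN_anti => //; lra.
(* k <= 2 (k - 1) and ln 2 <= 1 *)
have before : (1 + ln m.+1%:R) `^ (- p) <= r.
  apply: powRN_anti => //.
  have : ln k%:R <= ln (2 * m.+1%:R : R).
    rewrite ler_ln ?posrE// -natrM ler_nat mulSn mul1n addSn ltnS.
    exact: leq_addl.
  have ln21 : ln (2 : R) <= 1.
    by have := @le_ln1Dx R 1; rewrite -[1 + 1]/(2 : R); apply; lra.
  rewrite lnM ?posrE//; lra.
set c := log_filter_const p in C *.
have c0 : 0 <= c by exact: log_filter_const_ge0.
set n := nrm psi in C noise *.
have n0 : 0 <= n by exact: sip_norm_ge0.
have r0 : 0 <= r by exact: powR_ge0.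
have cn0 : 0 <= c * n by exact: mulr_ge0.
have cnr0 : 0 <= c * n * r by exact: mulr_ge0.
have lnow : lrate m.+1 * n <= c * n * r.
  by rewrite /lrate mulrAC ler_wpM2l.
have lbefore : lrate m * n <= c * n * r.
  by rewrite /lrate mulrAC ler_wpM2l.
have m1 : 0 < m.+1%:R :> R by [].
have epsm : m.+1%:R * eps <= c * n * r.
  apply: le_trans lbefore.
  by rewrite -ler_pdivlMl// mulrA.
have CE : C = 3 * (c * n) by rewrite /C; ring.
split.
  have := sip_normD ipP (phibar - phi k - op ((1 - 'X) ^+ m.+1) (B psi))
                        (op ((1 - 'X) ^+ m.+1) (B psi)).
  rewrite subrK => /le_trans; apply; rewrite CE.
  have := richardson_error m.+1; rewrite source => /le_trans/(_ epsm) err.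
  have src := le_trans (damped_source_le m.+1) lnow.
  apply: (le_trans (lerD err src)).
  rewrite [leRHS](_ : _ = 3 * (c * n * r)); last by ring.
  rewrite [leLHS](_ : _ = 2 * (c * n * r)); last by ring.
  by rewrite ler_wpM2r// ler_nat.
have eps1 : eps <= 2 * k%:R^-1 * (c * n * r).
  rewrite mulrAC ler_pdivlMr ?ltr0n//.
  have kk : k%:R <= 2 * m.+1%:R :> R.
    by rewrite -natrM ler_nat mulSn mul1n addSn ltnS leq_addl.
  by rewrite (le_trans (ler_wpM2l (ltW eps0) kk))// mulrCA ler_wpM2l// mulrC.
rewrite richardson_residual source (le_trans (sip_normD ipP _ _))//.
have h1 := damped_source_residual_le m.+1.
have h2 := le_trans (damping_operator_le m.+1 _) ze_z.
have h3 : k%:R^-1 * lrate m.+1 * n <= k%:R^-1 * (c * n * r).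
  by rewrite -mulrA ler_wpM2l ?invr_ge0.
apply: (le_trans (lerD (le_trans h1 h3) (le_trans h2 eps1))).
by rewrite CE le_eqVlt; apply/orP; left; apply/eqP; ring.
Qed.

End LogarithmicConvergenceRate.

(** * Open sets of the plane *)

Section PlaneMeasurability.
Variable R : realType.

(** The measurable structure is the product of two Borel structures; an open set
    is the countable union of the squares with rational centre and radius that it
    contains. *)
Lemma open_plane_measurable (U : set (plane R)) : open U -> measurable U.
Proof.
move=> oU.
pose sq (q1 q2 r : rat) : set (plane R) :=
  ball (ratr q1 : R) (ratr r) `*` ball (ratr q2 : R) (ratr r).
pose fam q1 q2 r := if `[< sq q1 q2 r `<=` U >] then sq q1 q2 r else set0.
have -> : U = \bigcup_q1 \bigcup_q2 \bigcup_r fam q1 q2 r.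
  apply/seteqP; split=> [x Ux|x [q1 _ [q2 _ [r _]]]]; last first.
    by rewrite /fam; case: asboolP => // h /h.
  have /nbhs_ballP[e /= e0 xeU] : nbhs x U by exact: open_nbhs_nbhs.
  have [r /[!in_itv]/= /andP[r0 re]] : exists r : rat, ratr r \in `]0, (e / 2)[.
    by apply: rat_in_itvoo; rewrite divr_gt0.
  have near_rat (y : R) : exists q : rat, `|ratr q - y| < ratr r.
    have [q /[!in_itv]/= /andP[q1 q2]] :
        exists q : rat, ratr q \in `]y, (y + ratr r)[.
      by apply: rat_in_itvoo; rewrite ltrDl.
    by exists q; rewrite gtr0_norm; lra.
  have [q1 xq1] := near_rat x.1; have [q2 xq2] := near_rat x.2.
  exists q1 => //; exists q2 => //; exists r => //; rewrite /fam.
  case: asboolP => [_|]; first by split; rewrite /ball/=.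
  have close (u v : R) (q : rat) : `|ratr q - u| < ratr r ->
      `|ratr q - v| < ratr r -> `|u - v| < e.
    move=> qu qv.
    rewrite (_ : u - v = (ratr q - v) - (ratr q - u)); last by ring.
    by rewrite (le_lt_trans (ler_normB _ _))//; lra.
  case=> y [/= y1 y2]; apply: xeU; split.
    exact: close xq1 y1.
  exact: close xq2 y2.
do 3 (apply: bigcupT_measurable_rat => ?).
rewrite /fam; case: asboolP => _ //.
by apply: measurableX; exact: measurable_ball.
Qed.

End PlaneMeasurability.

(** * Quadratic forms on square-integrable vector fields *)

Section QuadraticFormsOnFields.
Context {disp : measure_display} {T : measurableType disp} {R : realType}.
Variables (mu : {measure set T -> \bar R}) (D : set T) (n : nat).
Hypothesis mD : measurable D.
Implicit Types (f : T -> R) (g h : 'I_n -> T -> R).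

Definition square_summable f :=
  measurable_fun D f /\ mu.-integrable D (fun x => (f x ^+ 2)%:E).

Lemma square_summable_lin (c : R) f1 f2 :
  square_summable f1 -> square_summable f2 ->
  square_summable (fun x => c * f1 x + f2 x).
Proof.
move=> [m1 i1] [m2 i2].
have m : measurable_fun D (fun x => c * f1 x + f2 x).
  by apply: measurable_funD => //; exact: measurable_funM.
split=> //.
apply: (@le_integrable _ _ _ _ _ mD _
    (fun x => ((2 * c ^+ 2)%:E * (f1 x ^+ 2)%:E + 2%:E * (f2 x ^+ 2)%:E)%E)).
- by apply/measurable_EFinP; exact: measurable_funX.
- move=> x _; rewrite -!EFinM -EFinD lee_fin.
  rewrite ger0_norm ?sqr_ge0// (le_trans _ (ler_norm _))//.
  by have := sqr_ge0 (c * f1 x - f2 x); nra.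
- apply: integrableD => //; exact: integrableZl.
Qed.

Definition bounded_coefficient f :=
  measurable_fun D f /\ exists M : R, {ae mu, forall x, D x -> `|f x| <= M}.

Lemma bounded_mul_integrable (b f1 f2 : T -> R) :
  bounded_coefficient b -> square_summable f1 -> square_summable f2 ->
  mu.-integrable D (EFin \o (fun x => b x * f1 x * f2 x)).
Proof.
move=> [mb [M bM]] [m1 i1] [m2 i2].
have m : measurable_fun D (fun x => b x * f1 x * f2 x).
  by apply: measurable_funM => //; exact: measurable_funM.
have iM : mu.-integrable D
    (fun x => (`|M|%:E * ((f1 x ^+ 2)%:E + (f2 x ^+ 2)%:E))%E).
  by apply: integrableZl => //; exact: integrableD.
apply/integrableP; split; first exact/measurable_EFinP.
have [mM lM] := integrableP _ _ _ iM.
apply: le_lt_trans lM; apply: ae_ge0_le_integral => //.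
- by apply: measurableT_comp => //; exact/measurable_EFinP.
- by apply: measurableT_comp.
move: bM; apply: filterS => x bM Dx; rewrite /= lee_fin.
have bx := bM Dx; have M0 := normr_ge0 M; have b0 := normr_ge0 (b x).
have bxM : `|b x| <= `|M| by rewrite (le_trans bx)// ler_norm.
rewrite !normrM normr_id.
rewrite [`|f1 x ^+ 2 + _|]ger0_norm; last by rewrite addr_ge0 ?sqr_ge0.
rewrite -mulrA ler_pM// ?mulr_ge0//.
rewrite -(real_normK (num_real (f1 x))) -(real_normK (num_real (f2 x))).
have := sqr_ge0 (`|f1 x| - `|f2 x|).
have := normr_ge0 (f1 x); have := normr_ge0 (f2 x); nra.
Qed.

(** The indices are placed so that [field_density a (grad u) (grad v)] is the
    integrand of the weak formulation of [P u = 0], tested with [v]. *)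
Definition field_density (a : 'I_n -> 'I_n -> T -> R) g h (x : T) : R :=
  \sum_i \sum_j a i j x * g j x * h i x.

Definition field_form a g h : R := \int[mu]_(x in D) field_density a g h x.

Definition square_field g := forall i, square_summable (g i).

Definition field_lin (c : R) g h : 'I_n -> T -> R :=
  fun i x => c * g i x + h i x.

Lemma square_field_lin c g h :
  square_field g -> square_field h -> square_field (field_lin c g h).
Proof. by move=> sg sh i; exact: square_summable_lin. Qed.

Section Coefficients.
Variable a : 'I_n -> 'I_n -> T -> R.
Hypothesis ab : forall i j, bounded_coefficient (a i j).

Lemma field_density_integrable g h : square_field g -> square_field h ->
  mu.-integrable D (EFin \o field_density a g h).
Proof.
move=> sg sh.
rewrite (_ : _ \o _ = fun x =>
    (\sum_i \sum_j (a i j x * g j x * h i x)%:E)%E); last first.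
  apply/funext => x /=; rewrite /field_density -sumEFin.
  by apply: eq_bigr => i _; rewrite sumEFin.
apply: integrable_sum => // i _; apply: integrable_sum => // j _.
exact: bounded_mul_integrable.
Qed.

Lemma field_form_linl c g1 g2 h :
  square_field g1 -> square_field g2 -> square_field h ->
  field_form a (field_lin c g1 g2) h =
  c * field_form a g1 h + field_form a g2 h.
Proof.
move=> s1 s2 sh; rewrite /field_form.
have i1 := field_density_integrable s1 sh.
rewrite -RintegralZl// -RintegralD//.
- apply: eq_Rintegral => x _; rewrite /field_density mulr_sumr -big_split/=.
  apply: eq_bigr => i _; rewrite mulr_sumr -big_split/=.
  by apply: eq_bigr => j _; rewrite /field_lin; ring.
- exact: (integrableZl mD c i1).
- exact: field_density_integrable.
Qed.

Lemma field_form_linr c g h1 h2 :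
  square_field g -> square_field h1 -> square_field h2 ->
  field_form a g (field_lin c h1 h2) =
  c * field_form a g h1 + field_form a g h2.
Proof.
move=> sg s1 s2; rewrite /field_form.
have i1 := field_density_integrable sg s1.
rewrite -RintegralZl// -RintegralD//.
- apply: eq_Rintegral => x _; rewrite /field_density mulr_sumr -big_split/=.
  apply: eq_bigr => i _; rewrite mulr_sumr -big_split/=.
  by apply: eq_bigr => j _; rewrite /field_lin; ring.
- exact: (integrableZl mD c i1).
- exact: field_density_integrable.
Qed.

End Coefficients.

Definition unit_coefficients (i j : 'I_n) : T -> R := fun=> (i == j)%:R.

Lemma unit_coefficients_bounded i j :
  bounded_coefficient (unit_coefficients i j).
Proof.
split; first exact: measurable_cst.
by exists 1; apply: aeW => x _; rewrite normr_nat lern1 leq_b1.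
Qed.

Lemma field_density_unit g h x :
  field_density unit_coefficients g h x = \sum_i g i x * h i x.
Proof.
apply: eq_bigr => i _; rewrite (bigD1 i)//= big1 => [|j ji].
  by rewrite addr0 /unit_coefficients eqxx mul1r.
by rewrite /unit_coefficients eq_sym (negbTE ji) !mul0r.
Qed.

Lemma field_form_unit_ge0 g : 0 <= field_form unit_coefficients g g.
Proof.
apply: Rintegral_ge0 => x _; rewrite field_density_unit.
by apply: sumr_ge0 => i _; rewrite -expr2 sqr_ge0.
Qed.

Lemma field_form_unit_sym g h :
  field_form unit_coefficients g h = field_form unit_coefficients h g.
Proof.
apply: eq_Rintegral => x _; rewrite !field_density_unit.
by apply: eq_bigr => i _; rewrite mulrC.
Qed.

(** For every [t] the form is nonnegative at [t g + h], where it is an affine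
    function of [t] whose slope is twice its value at [(g, h)]. *)
Lemma null_field_orthogonal g h : square_field g -> square_field h ->
  field_form unit_coefficients g g = 0 -> field_form unit_coefficients g h = 0.
Proof.
move=> sg sh g0; apply/eqP/negPn/negP => gh0.
set b := field_form _ g h in gh0; pose c := field_form unit_coefficients h h.
(* for this t the form at t g + h would be -1 *)
have := field_form_unit_ge0 (field_lin (- (c + 1) / (2 * b)) g h).
have sl t := square_field_lin t sg sh.
rewrite (field_form_linl unit_coefficients_bounded)//.
rewrite !(field_form_linr unit_coefficients_bounded)// g0.
rewrite (field_form_unit_sym h g) -/b -/c mulr0 add0r.
have -> : - (c + 1) / (2 * b) * b + (- (c + 1) / (2 * b) * b + c) = - 1.
  by field.
by rewrite lerNr oppr0 ler10.
Qed.

Lemma coercive_null_field (a : 'I_n -> 'I_n -> T -> R) (alpha : R) g :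
  (forall i j, bounded_coefficient (a i j)) -> 0 < alpha -> square_field g ->
  {ae mu, forall x, D x ->
     alpha * \sum_i g i x ^+ 2 <= field_density a g g x} ->
  field_form a g g = 0 -> field_form unit_coefficients g g = 0.
Proof.
move=> ab alpha0 sg coercive a0; apply/eqP.
rewrite eq_le field_form_unit_ge0 andbT.
have ia := field_density_integrable ab sg sg.
have i1 := field_density_integrable unit_coefficients_bounded sg sg.
have mia := measurable_int _ ia; have mi1 := measurable_int _ i1.
have sumE x : field_density unit_coefficients g g x = \sum_i g i x ^+ 2.
  by rewrite field_density_unit; apply: eq_bigr => i _; rewrite expr2.
have sq0 x : 0 <= \sum_i g i x ^+ 2 by apply: sumr_ge0 => i _; exact: sqr_ge0.
have int_a0 : (\int[mu]_(x in D) (field_density a g g x)%:E = 0)%E.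
  rewrite -(fineK (integrable_fin_num mD ia)).
  by move: a0; rewrite /field_form /Rintegral => ->.
(* coercivity makes the density nonnegative almost everywhere *)
have int_abs : (\int[mu]_(x in D) `|(field_density a g g x)%:E| = 0)%E.
  rewrite -int_a0; apply: ae_eq_integral => //.
    exact: measurableT_comp.
  move: coercive; apply: filterS => x cx Dx; rewrite /= ger0_norm//.
  by rewrite (le_trans _ (cx Dx))// mulr_ge0// ltW.
have : (\int[mu]_(x in D)
    (alpha * field_density unit_coefficients g g x)%:E <= 0)%E.
  rewrite -int_abs; apply: ae_ge0_le_integral => //.
  - by move=> x _; rewrite lee_fin sumE mulr_ge0// ltW.
  - by under eq_fun do rewrite EFinM; exact: measurable_funeM.
  - exact: measurableT_comp.
  - move: coercive; apply: filterS => x cx Dx; rewrite /= lee_fin sumE.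
    by rewrite (le_trans (cx Dx))// ler_norm.
under eq_integral do rewrite EFinM.
rewrite integralZl// -(fineK (integrable_fin_num mD i1)) -EFinM lee_fin.
by rewrite pmulr_rle0.
Qed.

End QuadraticFormsOnFields.

(** * The energy inner product *)

Section EnergyInnerProduct.
Variables (R : realType) (Om G1 G2 : set (plane R)).
Variable a : 'I_2 -> 'I_2 -> plane R -> R.
Variable W : H00dual Om G2 G1 -> H1 Om.
Hypotheses (Om_open : open Om) (a_elliptic : elliptic_coefficients Om a).
Hypothesis W_lifting : is_lifting a W.
Local Notation energy := (field_form (leb2 R) Om a).
Local Notation dirichlet :=
  (field_form (leb2 R) Om (@unit_coefficients _ _ _ 2)).
Local Notation grW phi := (grad (W phi)).

Let mOm : measurable Om := open_plane_measurable Om_open.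
Let ab i j : bounded_coefficient (leb2 R) Om (a i j) := a_elliptic.1 i j.
Let square_grad u : square_field (leb2 R) Om (grad u) := @grad_sq R Om u.

Lemma elliptic_density_ge : exists2 alpha : R, 0 < alpha &
  forall g : 'I_2 -> plane R -> R, {ae leb2 R, forall x, Om x ->
     alpha * \sum_i g i x ^+ 2 <= field_density a g g x}.
Proof.
have [_ [alpha alpha0 ell]] := a_elliptic; exists alpha => // g.
move: ell; apply: filterS => x ell Ox.
have fE : field_density a g g x = \sum_i \sum_j
    (\row_k g k x) ord0 i * a i j x * (\row_k g k x) ord0 j.
  by apply: eq_bigr => i _; apply: eq_bigr => j _; rewrite !mxE; ring.
have sE : \sum_i g i x ^+ 2 = \sum_i (\row_k g k x) ord0 i ^+ 2.
  by apply: eq_bigr => i _; rewrite mxE.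
rewrite fE sE; have [->|g0] := eqVneq (\row_k g k x) 0; last exact/ltW/ell.
rewrite !big1 ?mulr0// => i _; last by rewrite mxE expr0n.
by rewrite big1// => j _; rewrite !mxE !mul0r.
Qed.

(** Green's formula for two liftings: both vanish at [G1], so each is an
    admissible test function for the other.  The right-hand side is visibly linear
    in [phi]. *)
Lemma energy_lifting phi chi :
  energy (grW phi) (grW chi) = phi (trace (W chi)).
Proof.
have [_ _ cW] := W_lifting phi; have [_ chi0 _] := W_lifting chi.
exact: cW.
Qed.

Lemma ip_starE phi psi : ip_star W phi psi = dirichlet (grW phi) (grW psi).
Proof. by apply: eq_Rintegral => x _; rewrite field_density_unit. Qed.

(** [W] is an arbitrary choice of solutions, so it is linear only up to functions
    of vanishing gradient.  The defect [d] of linearity of the gradients is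
    orthogonal for the energy form to all gradients of liftings by
    [energy_lifting], hence to itself, and ellipticity makes it null. *)
Lemma lifting_gradient_linear c phi psi chi :
  dirichlet (grW (c *: phi + psi)) (grW chi) =
  c * dirichlet (grW phi) (grW chi) + dirichlet (grW psi) (grW chi).
Proof.
pose s := field_lin c (grW phi) (grW psi).
pose d := field_lin (-1) s (grW (c *: phi + psi)).
have ss : square_field (leb2 R) Om s by exact: square_field_lin.
have sd : square_field (leb2 R) Om d by exact: square_field_lin.
have d_orth om : energy d (grW om) = 0.
  rewrite (field_form_linl mOm ab)// (field_form_linl mOm ab)//.
  by rewrite !energy_lifting mulN1r addNr.
have dd0 : energy d d = 0.
  rewrite {2}/d (field_form_linr mOm ab)// d_orth /s.
  by rewrite (field_form_linr mOm ab)// !d_orth !mulr0 !addr0 mulr0.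
have [alpha alpha0 ell] := elliptic_density_ge.
have d0 := coercive_null_field mOm ab alpha0 sd (ell d) dd0.
have := null_field_orthogonal mOm sd (square_grad (W chi)) d0.
have ub := unit_coefficients_bounded (leb2 R) Om (n := 2).
rewrite (field_form_linl mOm ub)// (field_form_linl mOm ub)//.
by move=> /eqP; rewrite mulN1r addrC subr_eq0 => /eqP.
Qed.

Lemma ip_star_semi_inner : semi_inner_product (ip_star W).
Proof.
split=> [c x y z|x y|x]; rewrite !ip_starE.
- exact: lifting_gradient_linear.
- exact: field_form_unit_sym.
- exact: field_form_unit_ge0.
Qed.

End EnergyInnerProduct.

(** * Convergence rates for the Cauchy problem *)

Theorem theorem14 (R : realType) :
  exists C : R -> R -> R,
  forall (Om G1 G2 : set (plane R)) (a : 'I_2 -> 'I_2 -> plane R -> R),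
  open Om -> bounded_set Om -> regular Om ->
  boundary_split Om G1 G2 ->
  elliptic_coefficients Om a ->
  forall (W : H00dual Om G2 G1 -> H1 Om),
  is_lifting a W ->
  let H := H00dual Om G2 G1 in
  let ip := ip_star W in
  let nrm := ip_norm ip in
  forall (f fe : plane R -> R) (g ge : H00dual Om G1 G2)
         (Tl : {linear H -> H}) (z ze : H),
  H12 Om G1 f -> consistent a f g ->
  affine_splitting a f g Tl z ->
  H12 Om G1 fe ->
  affine_splitting a fe ge Tl ze ->
  let A := fun phi : H => phi - Tl phi in
  [/\ self_adjoint ip Tl, non_negative ip Tl & non_expansive ip Tl] ->
  [/\ self_adjoint ip A, positive ip A, non_expansive ip A
    & compact_operator ip A] ->
  forall (p mu eps : R) (FA : H -> H) (phibar phi1 psi : H)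
         (phie : nat -> H) (K : nat),
  1 <= p -> 2 < mu -> 0 < eps ->
  Tl phibar + z = phibar ->
  functional_calculus ip 0 1 (log_source p) A FA ->
  phibar - phi1 = FA psi ->
  nrm (ze - z) <= eps ->
  phie 1%N = phi1 ->
  (forall k, (1 <= k)%N -> phie k.+1 = Tl (phie k) + ze) ->
  is_stopping_index (fun k => nrm (ze - A (phie k))) (mu * eps) K ->
  (* for k = 1 both right-hand sides are +oo, so only 1 < k is constrained *)
  forall k : nat, (1 < k <= K)%N ->
    nrm (phibar - phie k) <= C p (nrm psi) * ln k%:R `^ (- p) /\
    nrm (ze - A (phie k)) <=
      C p (nrm psi) * (k%:R^-1 * ln k%:R `^ (- p)).
Proof.
exists (fun p n => 3 * log_filter_const p * n).
move=> Om G1 G2 a Om_open _ _ _ a_ell W W_lift H ip nrm f fe g ge Tl z ze.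
move=> _ _ _ _ _ A [Tl_sa Tl_ge0 Tl_le] [A_sa A_pos _ _].
move=> p mu eps FA phibar phi1 psi phie K p1 mu2 eps0 fixed BF source noise.
move=> phi_1 phiS stop k kK.
have ipP : semi_inner_product ip by exact: ip_star_semi_inner a_ell W_lift.
pose AL : {linear H -> H} := (idfun \- Tl)%R.
have [_ A01 _] := BF.
have TlE x : x - AL x = Tl x by rewrite /AL /= opprB addrC subrK.
apply: (@richardson_log_rate R H ip AL ipP A_sa _ _ phie z ze phibar eps _ noise
  _ p mu FA psi K _ mu2 eps0 BF _ stop k kK).
- by move=> x; have := A01 x; rewrite mul0r mul1r.
- by move=> x; rewrite TlE; exact: Tl_le.
- by rewrite /AL/= -{1}fixed addrC addrA addNr add0r.
- by move=> j j1; rewrite phiS// TlE.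
- exact: le_trans p1.
- by rewrite phi_1.
Qed.
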